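(* Let $\mathcal{A}\in T_{m,n}$. Then $\mathcal{A}$ is an S-tensor if and only if the tensor complementarity problem TCP$(\mathcal{A},\mathbf{q})$ is feasible for all $\mathbf{q}\in\mathbb{R}^n$. Moreover, each Q-tensor in $T_{m,n}$ is an S-tensor.
   Context: $T_{m,n}$ denotes the set of all real $m$th order $n$-dimensional tensors $\mathcal{A}=(a_{i_1\cdots i_m})$, $1\le i_1,\dots,i_m\le n$, with order $m\ge 2$ (no symmetry is assumed). For $\mathbf{x}\in\mathbb{R}^n$, $\mathcal{A}\mathbf{x}^{m-1}\in\mathbb{R}^n$ is the vector with components $(\mathcal{A}\mathbf{x}^{m-1})_i=\sum_{i_2,\dots,i_m=1}^n a_{ii_2\cdots i_m}x_{i_2}\cdots x_{i_m}$. For vectors, $\mathbf{x}\ge\mathbf{0}$ (respectively $\mathbf{x}>\mathbf{0}$) means $x_i\ge 0$ (respectively $x_i>0$) for all $i$. $\mathcal{A}$ is an S-tensor iff the system $\mathcal{A}\mathbf{x}^{m-1}>\mathbf{0}$, $\mathbf{x}>\mathbf{0}$ has a solution $\mathbf{x}\in\mathbb{R}^n$. For $\mathbf{q}\in\mathbb{R}^n$, TCP$(\mathcal{A},\mathbf{q})$ is the problem of finding $\mathbf{x}\in\mathbb{R}^n$ with $\mathbf{x}\ge\mathbf{0}$, $\mathbf{q}+\mathcal{A}\mathbf{x}^{m-1}\ge\mathbf{0}$ and $\mathbf{x}^\top(\mathbf{q}+\mathcal{A}\mathbf{x}^{m-1})=0$; such an $\mathbf{x}$ is a solution, and the problem is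 solvable if a solution exists. It is feasible iff there exists $\mathbf{x}\in\mathbb{R}^n$ with $\mathbf{x}\ge\mathbf{0}$ and $\mathbf{q}+\mathcal{A}\mathbf{x}^{m-1}\ge\mathbf{0}$. $\mathcal{A}$ is a Q-tensor iff TCP$(\mathcal{A},\mathbf{q})$ is solvable for all $\mathbf{q}\in\mathbb{R}^n$. *)

(* Defs.v *)
From mathcomp Require Import all_boot all_order all_algebra.
From mathcomp Require Import reals.

Set Implicit Arguments.
Unset Strict Implicit.
Unset Printing Implicit Defensive.

Import Order.TTheory GRing.Theory Num.Theory.
Local Open Scope ring_scope.

(* The entry a_{i_1 ... i_m} is the value at the tuple (i_1, ..., i_m), with
   indices counted from 0; no symmetry is imposed. *)
Definition tensor (R : realType) (m n : nat) : Type :=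
  {ffun m.-tuple 'I_n -> R}.

(* A x^{m-1}: component i sums over the index tuples t = (i, i_2, ..., i_m),
   so that behead t = (i_2, ..., i_m).  Meaningful for m >= 1. *)
Definition tensor_apply (R : realType) (m n : nat) (A : tensor R m n)
    (x : 'cV[R]_n) : 'cV[R]_n :=
  \col_i \sum_(t : m.-tuple 'I_n | ohead t == Some i)
           A t * \prod_(j <- behead t) x j 0.

Definition vec_ge0 (R : realType) (n : nat) (v : 'cV[R]_n) : Prop :=
  forall i : 'I_n, 0 <= v i 0.

Definition vec_gt0 (R : realType) (n : nat) (v : 'cV[R]_n) : Prop :=
  forall i : 'I_n, 0 < v i 0.

Definition S_tensor (R : realType) (m n : nat) (A : tensor R m n) : Prop :=
  exists x : 'cV[R]_n, vec_gt0 (tensor_apply A x) /\ vec_gt0 x.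

Definition TCP_feasible (R : realType) (m n : nat) (A : tensor R m n)
    (q : 'cV[R]_n) : Prop :=
  exists x : 'cV[R]_n, vec_ge0 x /\ vec_ge0 (q + tensor_apply A x).

Definition TCP_solution (R : realType) (m n : nat) (A : tensor R m n)
    (q x : 'cV[R]_n) : Prop :=
  [/\ vec_ge0 x,
      vec_ge0 (q + tensor_apply A x) &
      x^T *m (q + tensor_apply A x) = 0].

Definition TCP_solvable (R : realType) (m n : nat) (A : tensor R m n)
    (q : 'cV[R]_n) : Prop :=
  exists x : 'cV[R]_n, TCP_solution A q x.

Definition Q_tensor (R : realType) (m n : nat) (A : tensor R m n) : Prop :=
  forall q : 'cV[R]_n, TCP_solvable A q.

(* Main.v *)
Require Import Defs.
From mathcomp Require Import all_boot all_order all_algebra.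
From mathcomp Require Import reals polyrcf.

(** The map [x |-> A x^(m-1)] is homogeneous of degree [m - 1 >= 1] and
    polynomial; each of these two features gives one half of the equivalence.

    If [x > 0] and [y = A x^(m-1) > 0], then along the ray through [x] the
    image [c^(m-1) y] eventually exceeds [-q] in every coordinate, whatever [q]
    is ([tensor_applyZ], [scaling_dominates]), so every problem is feasible.

    Conversely, feasibility for [q = (-1, ..., -1)] gives [x >= 0] with
    [A x^(m-1) >= 1].  Only the strict positivity of [x] is missing, and it is
    obtained by moving [x] to [x + t (1, ..., 1)] with a small [t > 0]: each
    component of the image is a polynomial in [t] ([apply_shift_polyE]) which is
    positive at [0], so all of them stay positive for some [t > 0]
    ([polys_gt0_right_of_0]).

    A solvable problem is in particular feasible, whence the claim on
    Q-tensors. *)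

Set Implicit Arguments.
Unset Strict Implicit.
Unset Printing Implicit Defensive.

Import Order.TTheory GRing.Theory Num.Theory.
Local Open Scope ring_scope.

Lemma tensor_applyZ (R : realType) (m n : nat) (A : tensor R m n) (c : R)
    (x : 'cV[R]_n) :
  tensor_apply A (c *: x) = c ^+ m.-1 *: tensor_apply A x.
Proof.
apply/colP => i; rewrite !mxE mulr_sumr; apply: eq_bigr => t _.
under eq_bigr => j _ do rewrite mxE.
by rewrite big_split /= big_const_seq count_predT iter_mulr_1 size_behead
  size_tuple mulrCA.
Qed.

(** One factor serves all coordinates at once: a factor [c >= 1] that exceeds
    the sum of the ratios [|q_i| / y_i] works, because [c <= c^k]. *)
Lemma scaling_dominates (R : realType) (n k : nat) (y q : 'cV[R]_n) :
  (0 < k)%N -> vec_gt0 y ->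
  exists2 c : R, 0 < c & vec_ge0 (q + c ^+ k *: y).
Proof.
move=> k_gt0 y_gt0.
have ratio_ge0 j : 0 <= `|q j 0| / y j 0 by rewrite divr_ge0 // ltW.
set s := \sum_j `|q j 0| / y j 0.
have s_ge0 : 0 <= s by apply: sumr_ge0.
exists (1 + s) => [|i]; first by rewrite ltr_wpDr.
rewrite !mxE -lerBlDl sub0r (le_trans (ler_norm _)) // normrN.
rewrite -ler_pdivrMr //.
have c_le_ck : 1 + s <= (1 + s) ^+ k by rewrite ler_eXnr ?lerDl.
apply: le_trans c_le_ck; rewrite /s (bigD1 i) //= ler_wpDl // lerDl.
exact: sumr_ge0.
Qed.

Lemma polys_gt0_right_of_0 (R : realType) (I : finType) (p : I -> {poly R}) :
  (forall i, 0 < (p i).[0]) -> exists2 t, 0 < t & forall i, 0 < (p i).[t].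
Proof.
move=> p0_gt0.
have [d d_gt0 d_close] :=
  fin_all_exists2 (fun i => poly_cont 0 (p i) (p0_gt0 i)).
pose e := \big[Num.min/1]_i d i.
have e_gt0 : 0 < e by apply: lt_bigmin.
have e2_gt0 : 0 < e / 2 by rewrite divr_gt0.
exists (e / 2) => // i.
have : `|e / 2 - 0| < d i.
  rewrite subr0 gtr0_norm //.
  apply: (@lt_le_trans _ _ e); last exact: bigmin_le.
  by rewrite ltr_pdivrMr // ltr_pMr // ltr1n.
by move/d_close; rewrite ltr_norml ltrBrDr addNr => /andP[].
Qed.

(** Component [i] of [A (x + t (1, ..., 1))^(m-1)], as a polynomial in [t]. *)
Definition apply_shift_poly (R : realType) (m n : nat) (A : tensor R m n)
    (x : 'cV[R]_n) (i : 'I_n) : {poly R} :=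
  \sum_(t : m.-tuple 'I_n | ohead t == Some i)
     (A t)%:P * \prod_(j <- behead t) ((x j 0)%:P + 'X).

Lemma apply_shift_polyE (R : realType) (m n : nat) (A : tensor R m n)
    (x : 'cV[R]_n) (i : 'I_n) (t : R) :
  (apply_shift_poly A x i).[t] = tensor_apply A (x + const_mx t) i 0.
Proof.
rewrite mxE horner_sum; apply: eq_bigr => u _.
rewrite hornerM hornerC horner_prod; congr (_ * _).
by apply: eq_bigr => j _; rewrite hornerD hornerC hornerX !mxE.
Qed.

(** Positivity of the image is an open condition, so a nonnegative witness can
    be pushed into the interior of the orthant. *)
Lemma S_tensor_of_ge0 (R : realType) (m n : nat) (A : tensor R m n)
    (x : 'cV[R]_n) :
  vec_ge0 x -> vec_gt0 (tensor_apply A x) -> S_tensor A.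
Proof.
move=> x_ge0 Ax_gt0.
have [i|t t_gt0 At_gt0] := polys_gt0_right_of_0 (p := apply_shift_poly A x).
  have x0 : x + const_mx 0 = x by apply/colP => j; rewrite !mxE addr0.
  by rewrite apply_shift_polyE x0.
exists (x + const_mx t); split=> i; first by rewrite -apply_shift_polyE.
by rewrite !mxE ltr_wpDl.
Qed.

Lemma S_tensor_feasible (R : realType) (m n : nat) (A : tensor R m n)
    (q : 'cV[R]_n) :
  (2 <= m)%N -> S_tensor A -> TCP_feasible A q.
Proof.
move=> m_ge2 [x [Ax_gt0 x_gt0]].
have m1_gt0 : (0 < m.-1)%N by rewrite -ltnS prednK // ltnW.
have [c c_gt0 qc_ge0] := scaling_dominates q m1_gt0 Ax_gt0.
exists (c *: x); rewrite tensor_applyZ; split=> // i.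
by rewrite mxE mulr_ge0 // ltW.
Qed.

Lemma feasible_S_tensor (R : realType) (m n : nat) (A : tensor R m n) :
  (forall q : 'cV[R]_n, TCP_feasible A q) -> S_tensor A.
Proof.
move=> /(_ (const_mx (-1)))[x [x_ge0 Ax_ge1]].
apply: (S_tensor_of_ge0 x_ge0) => i; apply: (lt_le_trans ltr01).
by have := Ax_ge1 i; rewrite mxE [const_mx _ _ _]mxE addrC subr_ge0.
Qed.

Theorem theorem3p2 (R : realType) (m n : nat) (hm : (2 <= m)%N)
    (A : tensor R m n) :
  (S_tensor A <-> (forall q : 'cV[R]_n, TCP_feasible A q)) /\
  (Q_tensor A -> S_tensor A).
Proof.
split.
  by split=> [SA q|]; [exact: S_tensor_feasible | exact: feasible_S_tensor].
move=> QA; apply: feasible_S_tensor => q.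
by have [x [x_ge0 qx_ge0 _]] := QA q; exists x.
Qed.
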